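(* Let $\mathcal{M}=(S,\mathit{Act},\mathbf{P},s^I)$ be an MDP and $G,E\subseteq S$ sets of states such that $\Pi_{\mathcal{M},E}\neq\emptyset$. Then for every $\lambda\in[0,1]$ and every relation ${\sim}\in\{<,\le,=,\ge,>\}$: \[ \Pr^{\max}_{\mathcal{M}}(\lozenge G \mid \lozenge E)\ \sim\ \lambda \quad\text{iff}\quad \max_{\sigma\in\Pi_{\mathcal{M},E}}\Big(\Pr^{\sigma}_{\mathcal{M}}(\lozenge G\cap\lozenge E)-\lambda\cdot \Pr^{\sigma}_{\mathcal{M}}(\lozenge E)\Big)\ \sim\ 0 . \]
   Context: A Markov decision process (MDP) is a tuple $\mathcal{M}=(S,\mathit{Act},\mathbf{P},s^I)$ with finite sets $S$ (states) and $\mathit{Act}$ (actions), an initial state $s^I\in S$, and a partial function $\mathbf{P}\colon S\times\mathit{Act}\rightharpoonup \mathit{Dist}(S)$ (probability distributions on $S$) such that the set $\mathit{Act}(s)$ of actions $\alpha$ for which $\mathbf{P}(s,\alpha)$ is defined is nonempty for every $s\in S$. A path is an infinite sequence $s_0\alpha_0s_1\alpha_1\dots$ with $\alpha_i\in\mathit{Act}(s_i)$ and $\mathbf{P}(s_i,\alpha_i)(s_{i+1})>0$. A policy maps every finite path prefix to an action enabled in its last state (policies may depend on the whole history); $\Pi_{\mathcal{M}}$ is the set of all policies. A policy $\sigma$ induces the standard probability measure $\Pr^\sigma_{\mathcal{M}}$ on paths starting in $s^I$. For $X\subseteq S$, $\lozenge X$ is the set of paths visiting some state of $X$. For measurable path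 sets $A,B$, $\Pr^\sigma_{\mathcal{M}}(A\mid B)=\Pr^\sigma_{\mathcal{M}}(A\cap B)/\Pr^\sigma_{\mathcal{M}}(B)$, defined iff $\Pr^\sigma_{\mathcal{M}}(B)>0$, and $\Pr^{\max}_{\mathcal{M}}(A\mid B)=\sup\{\Pr^\sigma_{\mathcal{M}}(A\mid B)\mid \sigma\in\Pi_{\mathcal{M}},\ \Pr^\sigma_{\mathcal{M}}(B)\neq 0\}$. Finally $\Pi_{\mathcal{M},E}=\{\sigma\in\Pi_{\mathcal{M}}\mid \Pr^\sigma_{\mathcal{M}}(\lozenge E)>0\}$.
   Formalization: The formal theorem assumes, for the given λ, that the maximum over Π_{M,E} is attained; for some MDPs with λ>0 it does not exist (policies reaching E with arbitrarily small probability, G empty), and with a supremum instead the equivalence fails. *)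

(* Defs.v *)
From HB Require Import structures.
From mathcomp Require Import all_boot all_order all_algebra.
From mathcomp Require Import all_classical all_reals all_analysis.

Set Implicit Arguments.
Unset Strict Implicit.
Unset Printing Implicit Defensive.
Import Order.TTheory GRing.Theory Num.Theory.
Local Open Scope classical_set_scope.
Local Open Scope ring_scope.

Record dist (R : realType) (S : finType) := Dist {
  pmf :> S -> R ;
  pmf_ge0 : forall s, 0 <= pmf s ;
  pmf_sum1 : \sum_s pmf s = 1 }.

(* [trans] is a partial function: [None] means that the action is disabled. *)
Record mdp (R : realType) (S Act : finType) := Mdp {
  init : S ;
  trans : S -> Act -> option (dist R S) ;
  trans_total : forall s, exists a, isSome (trans s a) }.

Section MDP.
Context {R : realType} {S Act : finType}.
Variable M : mdp R S Act.

Definition enabled (s : S) : {set Act} := [set a | isSome (trans M s a)].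

Definition prob (s : S) (a : Act) (s' : S) : R :=
  if trans M s a is Some d then d s' else 0.

Definition step (s : S) (a : Act) (s' : S) : bool :=
  (a \in enabled s) && (0 < prob s a s').

Record ipath := IPath {
  st : nat -> S ;
  ac : nat -> Act ;
  ipath_step : forall i, step (st i) (ac i) (st i.+1) }.

(* The finite sequence s0 a0 s1 ... a(n-1) sn is encoded as
   (s0, [:: (a0, s1); ...; (a(n-1), sn)]). *)
Fixpoint steps (s : S) (h : seq (Act * S)) : bool :=
  if h is (a, s') :: h' then step s a s' && steps s' h' else true.

Record hist := Hist {
  hval :> S * seq (Act * S) ;
  hist_steps : steps hval.1 hval.2 }.

HB.instance Definition _ := [isSub for hval].
HB.instance Definition _ := [Equality of hist by <:].

Definition hlast (h : S * seq (Act * S)) : S := last h.1 (unzip2 h.2).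

Record policy := Policy {
  pol :> hist -> Act ;
  pol_enabled : forall h : hist, pol h \in enabled (hlast h) }.

Definition hraw (w : ipath) (n : nat) : S * seq (Act * S) :=
  (st w 0, [seq (ac w i, st w i.+1) | i <- iota 0 n]).

Lemma hraw_steps (w : ipath) (n : nat) : steps (hraw w n).1 (hraw w n).2.
Proof.
rewrite /hraw /=; elim: n 0%N => //= n IH k.
by rewrite ipath_step /=; exact: IH.
Qed.

Definition hist_of (w : ipath) (n : nat) : hist := Hist (hraw_steps w n).

Definition cylinder (h : hist) : set ipath :=
  [set w | exists n, hist_of w n = h].

Lemma prob_ge0 s a s' : 0 <= prob s a s'.
Proof. by rewrite /prob; case: (trans M s a) => // d; exact: pmf_ge0. Qed.

Lemma prob_sum1 s a : a \in enabled s -> \sum_s' prob s a s' = 1.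
Proof.
by rewrite inE /prob; case: (trans M s a) => // d _; exact: pmf_sum1.
Qed.

Lemma stepE s a s' : step s a s' = (0 < prob s a s').
Proof.
by rewrite /step inE /prob; case: (trans M s a) => //=.
Qed.

Lemma ex_step s : exists x : Act * S, step s x.1 x.2.
Proof.
have [a ha] := trans_total M s.
have hs : \sum_s' prob s a s' = 1 by apply: prob_sum1; rewrite inE.
apply: contrapT => hn; have := oner_neq0 R; rewrite -hs big1 ?eqxx// => s' _.
apply/eqP; rewrite eq_le prob_ge0 andbT leNgt -stepE.
by apply/negP => h; apply: hn; exists (a, s').
Qed.

Let nx (s : S) := sval (cid (ex_step s)).

Definition ipath0 : ipath :=
  @IPath (fun i => iter i (fun s => (nx s).2) (init M))
         (fun i => (nx (iter i (fun s => (nx s).2) (init M))).1)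
         (fun i => svalP (cid (ex_step _))).

HB.instance Definition _ := gen_eqMixin ipath.
HB.instance Definition _ := gen_choiceMixin ipath.
HB.instance Definition _ := isPointed.Build ipath ipath0.

Definition pathspace := g_sigma_algebraType (range cylinder).
HB.instance Definition _ := Measurable.on pathspace.

Definition cylinder_prob (sigma : policy) (w : ipath) (n : nat) : R :=
  (st w 0 == init M)%:R *
  \prod_(i < n) ((sigma (hist_of w i) == ac w i)%:R *
                 prob (st w i) (ac w i) (st w i.+1)).

Lemma hlast_rcons s h a s' : hlast (s, rcons h (a, s')) = s'.
Proof. by rewrite /hlast /= /unzip2 map_rcons last_rcons. Qed.

Lemma hrawS (w : ipath) n : hraw w n.+1 =
  ((hraw w n).1, rcons (hraw w n).2 (ac w n, st w n.+1)).
Proof. by rewrite /hraw -[in iota _ n.+1]addn1 iotaD map_cat /= cats1. Qed.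

Lemma hlast_hraw (w : ipath) n : hlast (hraw w n) = st w n.
Proof.
by case: n => // n; rewrite hrawS hlast_rcons.
Qed.

Lemma cylinderE (w w' : ipath) n :
  cylinder (hist_of w n) w' <-> hist_of w' n = hist_of w n.
Proof.
split=> [[m] /[dup] e|e]; last by exists n.
move=> /(congr1 (fun h : hist => size (hval h).2)) /=.
by rewrite !size_map !size_iota => mn; rewrite mn in e.
Qed.

Section Existence.
Variable sigma : policy.

(* The witness is the image of the uniform distribution on [0, 1[ under a
   successive subdivision of that interval according to the transition
   probabilities. *)
Let rpol (h : S * seq (Act * S)) : Act :=
  if insub h is Some h' then sigma h' else xchoose (trans_total M (hlast h)).

Let rpol_en h : rpol h \in enabled (hlast h).
Proof.
rewrite /rpol; case: insubP => [h' _ <-|_]; first exact: pol_enabled.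
by rewrite inE; apply: (xchooseP (trans_total M (hlast h))).
Qed.

Let dst h s := prob (hlast h) (rpol h) s.

Let F h (k : nat) := \sum_(s | (enum_rank s < k)%N) dst h s.

Let F0 h : F h 0 = 0. Proof. by rewrite /F big_pred0. Qed.

Let F1 h : F h #|S| = 1.
Proof.
rewrite /F -(prob_sum1 (rpol_en h)); apply: eq_bigl => s.
by rewrite ltn_ord.
Qed.

Let FS h (s : S) : F h (enum_rank s).+1 = F h (enum_rank s) + dst h s.
Proof.
rewrite /F (bigD1 s) ?ltnS//= addrC; congr (_ + _).
apply: eq_bigl => t; rewrite ltnS leq_eqVlt -(inj_eq enum_rank_inj).
by rewrite -(inj_eq val_inj) /=; case: ltngtP.
Qed.

Let F_mono h i j : (i <= j)%N -> F h i <= F h j.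
Proof.
move=> ij; rewrite /F [leRHS](bigID (fun s => (enum_rank s < i)%N)) /=.
rewrite (eq_bigl (fun s => (enum_rank s < j)%N && (enum_rank s < i)%N)).
  by rewrite lerDl; apply: sumr_ge0 => s _; exact: prob_ge0.
by move=> s; case: ltnP => si; rewrite ?andbF// (leq_trans si ij).
Qed.

Let state := (S * seq (Act * S) * R * R)%type.

Let inpart (u : R) (h : S * seq (Act * S)) (l p : R) (s : S) :=
  (l + p * F h (enum_rank s) <= u) && (u < l + p * F h (enum_rank s).+1).

Let sel (u : R) h (l p : R) := odflt (init M) [pick s | inpart u h l p s].

Let nxt (u : R) (x : state) : state :=
  let: (h, l, p) := x in let s := sel u h l p in
  ((h.1, rcons h.2 (rpol h, s)), l + p * F h (enum_rank s), p * dst h s).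

Let X (u : R) n : state := iter n (nxt u) (init M, [::], 0, 1).

Let inpart_ex (u : R) h (l p : R) : l <= u < l + p -> exists s, inpart u h l p s.
Proof.
move=> /andP[lu ul].
suff H k : (k <= #|S|)%N -> u < l + p * F h k -> exists s, inpart u h l p s.
  by apply: (H #|S|) => //; rewrite F1 mulr1.
elim: k => [_|k IH kS uk]; first by rewrite F0 mulr0 addr0 ltNge lu.
have [uk'|uk'] := ltP u (l + p * F h k); first exact: IH (ltnW kS) uk'.
by exists (enum_val (Ordinal kS)); rewrite /inpart enum_valK uk' uk.
Qed.

Let inpart_uniq (u : R) h (l p : R) s t : 0 <= p ->
  inpart u h l p s -> inpart u h l p t -> s = t.
Proof.
move=> p0.
have H a b : (enum_rank a < enum_rank b)%N ->
    inpart u h l p a -> inpart u h l p b -> False.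
  move=> ab /andP[_ ua] /andP[ub _].
  move: (lt_le_trans ua (le_trans (lerD (lexx l)
    (ler_wpM2l p0 (F_mono h ab))) ub)); by rewrite ltxx.
move=> hs ht; apply: enum_rank_inj; apply: val_inj => /=.
by case: (ltngtP (enum_rank s) (enum_rank t)) => // /H H';
  [case: (H' hs ht)|case: (H' ht hs)].
Qed.

Let selP (u : R) h (l p : R) :
  l <= u < l + p -> inpart u h l p (sel u h l p).
Proof.
move=> /inpart_ex -/(_ h)[s hs]; rewrite /sel.
by case: pickP => //= H; move: (H s); rewrite hs.
Qed.

Let X_inv (u : R) n : 0 <= u < 1 ->
  (X u n).1.2 <= u < (X u n).1.2 + (X u n).2 /\ 0 < (X u n).2.
Proof.
move=> u01; elim: n => [|n]; first by rewrite /X /= add0r.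
rewrite /X iterS -/(X u n); case: (X u n) => [[h l] p] /= [lup p0].
have := selP h lup; rewrite /inpart FS mulrDr addrA => H; split => //.
by have /andP[/le_lt_trans/[apply]] := H; rewrite ltrDl.
Qed.

Let X_step (u : R) n : 0 <= u < 1 ->
  step (hlast (X u n).1.1) (rpol (X u n).1.1) (hlast (X u n.+1).1.1).
Proof.
move=> u01; rewrite stepE; have [lup p0] := X_inv n u01.
have [_] := X_inv n.+1 u01; move: lup p0; rewrite /X iterS -/(X u n).
case: (X u n) => [[h l] p] /= _ p0.
rewrite pmulr_rgt0// /dst => H.
by rewrite hlast_rcons.
Qed.

Let coding (u : R) : ipath :=
  if pselect (forall n, step (hlast (X u n).1.1) (rpol (X u n).1.1)
                          (hlast (X u n.+1).1.1)) is left H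
  then IPath H else ipath0.

Let X_raw (u : R) n : 0 <= u < 1 -> (X u n).1.1 = hraw (coding u) n.
Proof.
move=> u01; rewrite /coding; case: pselect => [H|]; last first.
  by move=> H; exfalso; apply: H => i; exact: X_step.
elim: n => // n IH; rewrite hrawS -IH.
have -> : ac (IPath H) n = rpol (X u n).1.1 by [].
have -> : st (IPath H) n.+1 = hlast (X u n.+1).1.1 by [].
rewrite /X iterS -/(X u n).
by case: (X u n) => [[h l] p] /=; rewrite hlast_rcons.
Qed.

Let compat (w : ipath) n :=
  (st w 0 == init M) && [forall i : 'I_n, ac w i == rpol (hraw w i)].

Let compatS w n : compat w n.+1 = compat w n && (ac w n == rpol (hraw w n)).
Proof.
rewrite /compat -andbA; congr (_ && _); apply/forallP/andP => [H|[/forallP H Hn] i].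
  split; last exact: (H ord_max).
  by apply/forallP => i; exact: (H (widen_ord (leqnSn n) i)).
have := ltn_ord i; rewrite ltnS leq_eqVlt => /orP[/eqP->//|ni].
exact: (H (Ordinal ni)).
Qed.

Let LW (w : ipath) := fix LW n : R * R := if n is m.+1 then
   let: (l, p) := LW m in
   (l + p * F (hraw w m) (enum_rank (st w m.+1)), p * dst (hraw w m) (st w m.+1))
 else (0, 1).

Let X_LW (u : R) w n : 0 <= u < 1 -> hist_of (coding u) n = hist_of w n ->
  compat w n /\ X u n = (hraw w n, (LW w n).1, (LW w n).2).
Proof.
move=> u01 /(congr1 hval) /=; rewrite -X_raw//; elim: n => [|n IH].
  rewrite /X /hraw /= => -[e]; split; last by rewrite e.
  by rewrite /compat -e eqxx; apply/forallP; case.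
rewrite hrawS /X iterS -/(X u n) compatS; move: IH.
case: (X u n) => [[h l] p] /= IH [h1] /rcons_inj[h2 ha hs].
have e : h = hraw w n by case: h h1 h2 {IH ha hs} => ? ? /= -> ->.
subst h; have [-> [El Ep]] := IH erefl; rewrite ha eqxx hs; split=> //=.
by rewrite El Ep; case: (LW w n).
Qed.

Let LW_X (u : R) w n : compat w n -> (LW w n).1 <= u < (LW w n).1 + (LW w n).2 ->
  0 <= u < 1 /\ X u n = (hraw w n, (LW w n).1, (LW w n).2).
Proof.
elim: n => [|n IH].
  by rewrite /= add0r /compat => /andP[/eqP e _] u01; rewrite /X /hraw /= e.
rewrite compatS => /andP[cn /eqP an].
have pn : 0 <= (LW w n).2.
  by elim: (n) => //= m; case: (LW w m) => l p /= p0; rewrite mulr_ge0// prob_ge0.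
move: IH pn; rewrite hrawS /X iterS -/(X u n) /=.
case: (LW w n) => [l p] /= IH p0 lup.
have hin : inpart u (hraw w n) l p (st w n.+1).
  by rewrite /inpart FS mulrDr addrA.
have lup' : l <= u < l + p.
  case/andP: hin => h1 h2; apply/andP; split.
    apply: le_trans h1; rewrite lerDl mulr_ge0// -(F0 (hraw w n)).
    exact: F_mono.
  apply: (lt_le_trans h2); rewrite lerD2l -[leRHS]mulr1 ler_wpM2l//.
  by rewrite -(F1 (hraw w n)) F_mono.
have [u01 ->] := IH cn lup'; split => //=.
have -> : sel u (hraw w n) l p = st w n.+1.
  exact: (inpart_uniq p0 (selP _ lup') hin).
by rewrite -an.
Qed.

Let LW_prob w n : compat w n -> (LW w n).2 = cylinder_prob sigma w n.
Proof.
elim: n => [|n IH]; first by move=> /andP[e _]; rewrite /cylinder_prob big_ord0 e mulr1.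
rewrite compatS /cylinder_prob big_ord_recr/= mulrA -/(cylinder_prob _ _ n).
move=> /andP[/IH]; case: (LW w n) => [l p] /= -> /eqP an.
have sa : sigma (hist_of w n) = rpol (hraw w n).
  rewrite /rpol; case: insubP => [h _ e|]; last by rewrite hraw_steps.
  by congr (sigma _); apply: val_inj; rewrite e.
by rewrite sa -an eqxx mul1r /dst -an hlast_hraw.
Qed.

Let ncompat_prob w n : ~~ compat w n -> cylinder_prob sigma w n = 0.
Proof.
elim: n => [|n IH].
  rewrite /compat /cylinder_prob negb_and => /orP[/negbTE->|]; first by rewrite mul0r.
  by move=> /negP[]; apply/forallP; case.
rewrite compatS /cylinder_prob big_ord_recr/= mulrA -/(cylinder_prob _ _ n).
rewrite negb_and => /orP[/IH->|an]; first by rewrite mul0r.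
have sa : sigma (hist_of w n) = rpol (hraw w n).
  rewrite /rpol; case: insubP => [h _ e|]; last by rewrite hraw_steps.
  by congr (sigma _); apply: val_inj; rewrite e.
by rewrite sa eq_sym (negbTE an) mul0r mulr0.
Qed.

Let U : set R := `[0, 1[.

Let preE w n : U `&` coding @^-1` cylinder (hist_of w n) =
  if compat w n then `[(LW w n).1, (LW w n).1 + (LW w n).2[%classic else set0.
Proof.
apply/seteqP; split=> [u [] /=|u].
  rewrite /U /= in_itv /= => u01 /cylinderE /(X_LW u01)[-> e].
  have [] := X_inv n u01; rewrite e /= => H _.
  by rewrite in_itv.
case: ifPn => // c; rewrite /= in_itv /= => H.
have [u01 e] := LW_X c H; split; first by rewrite /U /= in_itv.
by apply/cylinderE/val_inj; rewrite /= -X_raw// e.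
Qed.

Let mU : measurable U. Proof. exact: measurable_itv. Qed.

Let mu : set (measurableTypeR R) -> \bar R := mrestr lebesgue_measure mU.
HB.instance Definition _ := Measure.on mu.

Let mu1 : mu setT = 1%E.
Proof.
by rewrite /mu /mrestr setTI lebesgue_measure_itv/= lte_fin ltr01 oppr0 adde0.
Qed.
HB.instance Definition _ := Measure_isProbability.Build _ _ _ mu mu1.

Let coding' (u : measurableTypeR R) : pathspace :=
  if u \in U then coding u else ipath0.

Let measurable_coding : measurable_fun setT coding'.
Proof.
apply: (@measurability _ _ _ _ setT coding' (range cylinder)) => //.
move=> _ [_ [h _ <-]] <-; rewrite setTI.
have -> : coding' @^-1` cylinder h = (U `&` coding @^-1` cylinder h) `|`
    (~` U `&` (if ipath0 \in cylinder h then setT else set0)).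
  apply/seteqP; split=> u /=; rewrite /coding'; case: (boolP (u \in U)) => uU.
  - by move=> ?; left; split=> //; exact/set_mem.
  - move=> H; right; split; first by move/mem_set => H'; rewrite H' in uU.
    by rewrite mem_set.
  - by case=> -[]; [move=> _ H; exact: H|move=> /(_ (set_mem uU))].
  - case=> -[]; first by move/mem_set => H'; rewrite H' in uU.
    by move=> _; case: ifPn => // /set_mem.
apply: measurableU; last first.
  by apply: measurableI; [exact: measurableC|case: ifP].
have [[w [n e]]|H] := pselect (cylinder h !=set0).
  by rewrite -e preE; case: ifP => // _; exact: measurable_itv.
suff -> : cylinder h = set0 by rewrite preimage_set0 setI0.
by apply: contrapT => /eqP/set0P.
Qed.
HB.instance Definition _ :=
  isMeasurableFun.Build _ _ _ _ coding' measurable_coding.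

Lemma path_measure_exists : exists P : probability pathspace R,
  forall (w : ipath) (n : nat),
    P (cylinder (hist_of w n)) = (cylinder_prob sigma w n)%:E.
Proof.
exists (distribution mu coding') => w n.
rewrite /distribution /= /pushforward /mu /mrestr.
have -> : coding' @^-1` cylinder (hist_of w n) `&` U =
    U `&` coding @^-1` cylinder (hist_of w n).
  apply/seteqP; split=> u /=; rewrite /coding' => -[].
    by move=> + h2; rewrite mem_set.
  by move=> h2; rewrite mem_set.
rewrite preE; case: ifPn => c; last by rewrite measure0 ncompat_prob.
rewrite lebesgue_measure_itv /= -(LW_prob c) lte_fin ltrDl.
case: ltP => [_|]; first by rewrite -EFinB addrAC subrr add0r.
rewrite (LW_prob c) => H; congr _%:E; apply/eqP; rewrite eq_le H andbT.
rewrite mulr_ge0// prodr_ge0// => i _; apply: mulr_ge0 => //; exact: prob_ge0.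
Qed.

End Existence.
Lemma path_measure_unique (P Q : probability pathspace R) :
  (forall w n, P (cylinder (hist_of w n)) = Q (cylinder (hist_of w n))) ->
  forall A, measurable A -> P A = Q A.
Proof.
move=> PQ; pose G : set (set pathspace) := range cylinder `|` [set set0; setT].
have trunc v w n m : (n <= m)%N ->
    hist_of v m = hist_of w m -> hist_of v n = hist_of w n.
  move=> nm /(congr1 hval) /= e; apply: val_inj => /=.
  have [e1 e2] : st v 0 = st w 0 /\ (hraw v m).2 = (hraw w m).2 by case: e.
  have tk x : (hraw x n).2 = take n (hraw x m).2.
    by rewrite -map_take take_iota (minn_idPl nm).
  by rewrite [LHS]surjective_pairing [RHS]surjective_pairing !tk e2 /= e1.
apply: (@measure_unique _ _ _ G (fun=> setT)) => //.
- apply/seteqP; split; apply: smallest_sub; try exact: smallest_sigma_algebra.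
  + by move=> _ [h _ <-]; apply: sub_gen_smallest; left; exists h.
  + move=> _ [[h _ <-]|[]->].
    * by apply: sub_gen_smallest; exists h.
    * exact: (@measurable0 _ pathspace).
    * exact: (@measurableT _ pathspace).
- have HG h1 h2 : G (cylinder h1 `&` cylinder h2).
    have [[v [[n en] [m em]]]|H] := pselect (cylinder h1 `&` cylinder h2 !=set0);
      last by right; left; apply: contrapT => /eqP/set0P.
    rewrite -en -em; case: (leqP n m) => nm; left.
      exists (hist_of v m) => //; apply/seteqP; split=> w /=.
        by move/cylinderE => e; split; apply/cylinderE => //; exact: (trunc _ _ _ m).
      by case.
    exists (hist_of v n) => //; apply/seteqP; split=> w /=.
      by move/cylinderE => e; split; apply/cylinderE => //;
        exact: (trunc _ _ _ n (ltnW nm)).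
    by case.
  move=> A B [[h _ <-]|[]->] [[h' _ <-]|[]->]; rewrite ?(setI0,set0I,setIT,setTI);
    solve [exact: HG|by left; exists h|by left; exists h'|by right; left|by right; right].
- by move=> _; right; right.
- by apply/seteqP; split=> // w _; exists 0%N.
- move=> _ [[h _ <-]|[]->]; last 2 first.
  + by rewrite !measure0.
  + exact: etrans (probability_setT P) (esym (probability_setT Q)).
  have [[w [n <-]]|H] := pselect (cylinder h !=set0); first exact: PQ.
  suff -> : cylinder h = set0 by rewrite !measure0.
  by apply: contrapT => /eqP/set0P.
- by move=> _; apply: (le_lt_trans (probability_le1 P measurableT)); rewrite ltry.
Qed.

(* The path measure of [sigma]: the only probability measure on [pathspace] with
   the values [cylinder_prob sigma] on cylinders. *)
Definition Pr (sigma : policy) : probability pathspace R :=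
  sval (cid (path_measure_exists sigma)).

Lemma Pr_cylinder (sigma : policy) (w : ipath) (n : nat) :
  Pr sigma (cylinder (hist_of w n)) = (cylinder_prob sigma w n)%:E.
Proof. exact: (svalP (cid (path_measure_exists sigma))). Qed.

Definition pr (sigma : policy) (A : set pathspace) : R := fine (Pr sigma A).

(* Used only when [pr sigma B != 0]. *)
Definition cond_pr (sigma : policy) (A B : set pathspace) : R :=
  pr sigma (A `&` B) / pr sigma B.

Definition max_cond_pr (A B : set pathspace) : R :=
  sup [set cond_pr sigma A B | sigma in [set sigma | pr sigma B != 0]].

Definition reach (X : {set S}) : set pathspace :=
  [set w | exists n, st w n \in X].

Definition policies_reaching (X : {set S}) : set policy :=
  [set sigma | 0 < pr sigma (reach X)].

End MDP.

Arguments reach {R S Act} M X.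
Arguments policies_reaching {R S Act} M X.

Variant cmp := cmp_lt | cmp_le | cmp_eq | cmp_ge | cmp_gt.

Definition cmp_rel (R : realType) (c : cmp) (x y : R) : bool :=
  match c with
  | cmp_lt => x < y
  | cmp_le => x <= y
  | cmp_eq => x == y
  | cmp_ge => x >= y
  | cmp_gt => x > y
  end.

(* An attained maximum, not merely a least upper bound. Over [policies_reaching]
   the two differ: if every E-reaching policy reaches E with positive but
   arbitrarily small probability, the objective with G empty and lambda > 0 has
   least upper bound 0 and no maximum. *)
Definition is_max (R : realType) (A : set R) (m : R) : Prop :=
  A m /\ ubound A m.

(* Main.v *)
Require Import Defs.
From HB Require Import structures.
From mathcomp Require Import all_boot all_order all_algebra.
From mathcomp Require Import all_classical all_reals all_analysis.

Set Implicit Arguments.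
Unset Strict Implicit.
Unset Printing Implicit Defensive.
Import Order.TTheory GRing.Theory Num.Theory.
Local Open Scope classical_set_scope.
Local Open Scope ring_scope.

(** For a policy with Pr(<>E) > 0, dividing by Pr(<>E) shows that its objective has the same sign as
    its conditional probability minus [lambda]. Hence the maximiser bounds the supremum p from
    below, strictly if [m > 0]; attainment matters at [m = 0]. All policies together bound p from
    above. So the sign of [m] is the sign of p - [lambda], which settles every relation at once. *)

Section Reach.
Context {R : realType} {S Act : finType} (M : mdp R S Act).

(** A visit to [X] is witnessed by a finite prefix ending in [X], and there are only countably many
    prefixes. *)
Lemma measurable_reach (X : {set S}) : measurable (reach M X).
Proof.
(* Indexing by raw sequences instead of [hist] makes the index type visibly countable; sequences
   that are not valid histories contribute the empty set. *)
pose C (h : S * seq (Act * S)) : set (pathspace M) :=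
  [set w | exists n, hraw w n = h].
have -> : reach M X = \bigcup_(h in [set h | hlast h \in X]) C h.
  apply/seteqP; split=> [w [n wX]|w [h /= hX [n hn]]].
    by exists (hraw w n); [rewrite /= hlast_hraw|exists n].
  by exists n; rewrite -hlast_hraw hn.
rewrite bigcup_mkcond.
apply: countable_bigcupT_measurable => [|h]; first exact: countableP.
case: ifP => _; last exact: measurable0.
have [hs|hs] := boolP (steps M h.1 h.2); last first.
  suff -> : C h = set0 by [].
  by rewrite -subset0 => w [n wh]; move: hs; rewrite -wh hraw_steps.
apply: sub_gen_smallest; exists (Hist hs) => //.
apply/seteqP; split=> w [n]; last by move=> wh; exists n; exact/val_inj.
by move=> /(congr1 (@hval _ _ _ _)) /= wh; exists n.
Qed.

Lemma pr_ge0 (sigma : policy M) (A : set (pathspace M)) : 0 <= pr sigma A.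
Proof. exact: fine_ge0. Qed.

Lemma pr_le1 (sigma : policy M) (A : set (pathspace M)) :
  measurable A -> pr sigma A <= 1.
Proof.
move=> mA; rewrite -lee_fin /pr fineK; first exact: probability_le1.
exact: fin_num_measure.
Qed.

Lemma le_pr (sigma : policy M) (A B : set (pathspace M)) :
  measurable A -> measurable B -> A `<=` B -> pr sigma A <= pr sigma B.
Proof.
move=> mA mB AB; apply: fine_le; [exact: fin_num_measure..|].
by apply: le_measure => //; rewrite inE.
Qed.

Lemma pr_neq0 (sigma : policy M) (A : set (pathspace M)) :
  (pr sigma A != 0) = (0 < pr sigma A).
Proof. by rewrite lt0r pr_ge0 andbT. Qed.

(** A real [sup] is an upper bound only for a set bounded above; here 1 is a bound, by monotonicity
    of the measure. *)
Lemma cond_pr_le_max (sigma : policy M) (A B : set (pathspace M)) :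
  measurable A -> measurable B -> 0 < pr sigma B ->
  cond_pr sigma A B <= max_cond_pr A B.
Proof.
move=> mA mB B0; apply: ub_le_sup; last first.
  by exists sigma => //=; rewrite pr_neq0.
exists 1 => _ [tau + <-]; rewrite /= pr_neq0 => tB.
rewrite /cond_pr ler_pdivrMr// mul1r.
by apply: le_pr => //; exact: measurableI.
Qed.

End Reach.

Theorem theorem1 (R : realType) (S Act : finType) (M : mdp R S Act)
    (G E : {set S}) (hE : policies_reaching M E !=set0)
    (lambda : R) (hlambda : 0 <= lambda <= 1) (rel : cmp)
    (m : R)
    (hm : is_max [set pr sigma (reach M G `&` reach M E)
                      - lambda * pr sigma (reach M E)
                 | sigma in policies_reaching M E] m) :
  cmp_rel rel (max_cond_pr (reach M G) (reach M E)) lambda <-> cmp_rel rel m 0.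
Proof.
have [[sigma sE sm] ubm] := hm.
have mG := @measurable_reach _ _ _ M G; have mE := @measurable_reach _ _ _ M E.
have le_max := cond_pr_le_max mG mE sE.
set p := max_cond_pr _ _ in le_max *.
(* [sigma] attains [m], so the sign of [m] compares its own conditional probability with
   [lambda]. *)
have p_gt : 0 < m -> lambda < p.
  move=> m0; apply: lt_le_trans le_max.
  by rewrite /cond_pr ltr_pdivlMr// -subr_gt0 sm.
have p_ge : 0 <= m -> lambda <= p.
  move=> m0; apply: le_trans le_max.
  by rewrite /cond_pr ler_pdivlMr// -subr_ge0 sm.
(* As Pr(<>E) <= 1, m <= 0 gives Pr(<>G | <>E) <= lambda + m / Pr(<>E)
   <= lambda + m: this bound is uniform, so a strict gap survives the sup. *)
have p_le : m <= 0 -> p <= lambda + m.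
  move=> m0; apply: ge_sup.
    exists (cond_pr sigma (reach M G) (reach M E)), sigma => //=.
    by rewrite pr_neq0.
  move=> _ [tau + <-]; rewrite /= pr_neq0 => tE.
  have := ubm _ (ex_intro2 _ _ tau tE erefl); rewrite lerBlDl => le_m.
  rewrite /cond_pr ler_pdivrMr// (le_trans le_m)// mulrDl lerD2l.
  by rewrite -[leLHS]mulr1 ler_wnM2l// pr_le1.
(* The three cases are exclusive for [m] against 0 and for p against [lambda], so one-way
   implications suffice; at [m = 0], [p_ge] and [p_le] squeeze p. *)
have [m0|m0|m0] := ltgtP m 0.
- have : p < lambda by rewrite (le_lt_trans (p_le (ltW m0)))// gtrDl.
  by case: rel => /=; case: (ltgtP p lambda) => // _; case: (ltgtP m 0) m0.
- have := p_gt m0.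
  by case: rel => /=; case: (ltgtP p lambda) => // _; case: (ltgtP m 0) m0.
- have -> : p = lambda.
    by apply/eqP; rewrite eq_le p_ge ?m0// -[leRHS]addr0 -m0 p_le ?m0.
  by rewrite m0; case: rel; rewrite /= ?ltxx ?lexx ?eqxx.
Qed.
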